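(* Let $\{y^n\}$ be generated by the distributed dual ascent algorithm (described in the context) with sets $S_n\subset\mathcal V$. Suppose that there is an integer $T$ such that for every $n\ge1$, the sets $\{S_{n+i}\}_{i=1}^T$ satisfy the following: (a) Suppose $S',S''$ are elements in $\{S_{n+i}\}_{i=1}^T$ such that $S'\cap S''\ne\emptyset$ and $y\in X^{|\mathcal V|}$. Then for all $d\in\mathcal D(S'\cup S'')$, we can find $d'\in\mathcal D(S')$ and $d''\in\mathcal D(S'')$ such that $d=d'+d''$ and $G'(y;d)=G'(y;d')+G'(y;d'')$. (b) Suppose $y\in X^{|\mathcal V|}$. If for all $r\in\{1,\dots,T\}$, $G'(y;d_r)\ge0$ for all $d_r\in\mathcal D(S_{n+r})$, then $y$ is a minimizer of $G(\cdot)$. Suppose further that the sequence $\{y^n\}_{n=1}^\infty$ is bounded. Then every cluster point of $\{y^n\}_{n=1}^\infty$ is a minimizer of $G$.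
   Context: $X$ is a finite dimensional Hilbert space, $\mathcal V$ is the finite vertex set of a connected undirected graph, $\bar{\mathbb R}=\mathbb R\cup\{\infty\}$, and $f_i:X\to\bar{\mathbb R}$, $i\in\mathcal V$, are closed convex functions with Fenchel conjugates $f_i^*$. Define $G:X^{|\mathcal V|}\to\bar{\mathbb R}$ by $G(y)=\sum_{i\in\mathcal V}f_i^*(y_i)$, and let $G'(y;d)$ be the directional derivative of $G$ at $y$ in the direction $d$. For $S\subset\mathcal V$, $\mathcal D(S)=\{d\in X^{|\mathcal V|}:\sum_{i\in\mathcal V}d_i=0\text{ and }\{i:d_i\neq0\}\subset S\}$. The dual problem considered is: maximize $-\sum_{i\in\mathcal V}f_i^*(y_i)$ over $\{y_i\}_{i\in\mathcal V}\subset X$ subject to $\sum_{i\in\mathcal V}y_i=0$. Distributed dual ascent algorithm for this problem: let $\{y_i^0\}_{i\in\mathcal V}\subset X$ be starting variables such that $\sum_{i\in\mathcal V}y_i^0=0$. For $n=1,2,\dots$: find a set $S_n\subset\mathcal V$ such that $|S_n|\ge2$; define $\{y_i^n\}_{i\in S_n}$ to be an element of the set of maximizers of $-\sum_{i\in S_n}f_i^*(y_i)$ over $\{y_i\}_{i\in S_n}\subset X$ subject to $\sum_{i\in S_n}y_i=\sum_{i\in S_n}y_i^{n-1}$; define $y_i^n=y_i^{n-1}$ for all $i\notin S_n$. *)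

(* Defs.v *)
From mathcomp Require Import all_boot all_order all_algebra.
From mathcomp Require Import all_classical all_reals all_analysis.
Set Implicit Arguments.
Unset Strict Implicit.
Unset Printing Implicit Defensive.
Import Order.TTheory GRing.Theory Num.Theory.
Import numFieldNormedType.Exports.
Local Open Scope classical_set_scope.
Local Open Scope ring_scope.

(* A finite dimensional real Hilbert space is a normed module whose norm comes
   from an inner product and which is spanned by finitely many vectors
   (completeness is then automatic). *)
Definition norm_from_dot (R : realType) (X : normedModType R)
    (dot : {dot X for idfun}) : Prop :=
  forall x : X, `|x| ^+ 2 = dot x x.

Definition finite_dimensional (R : realType) (X : normedModType R) : Prop :=
  exists (m : nat) (b : 'I_m -> X),
    forall x : X, exists c : 'I_m -> R, x = \sum_(i < m) c i *: b i.

(* The empty product 0 * +oo is 0 in \bar R, so t = 0 and t = 1 are harmless. *)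
Definition convex_ereal (R : realType) (X : normedModType R)
    (f : X -> \bar R) : Prop :=
  forall (x z : X) (t : R), 0 <= t <= 1 ->
    (f (t *: x + (1 - t) *: z)%R
       <= t%:E * f x + (1 - t)%:E * f z)%E.

Definition closed_convex (R : realType) (X : normedModType R)
    (f : X -> \bar R) : Prop :=
  [/\ forall x, f x != -oo%E, convex_ereal f & lower_semicontinuous f].

Definition conjugate (R : realType) (X : normedModType R)
    (dot : {dot X for idfun}) (f : X -> \bar R) (y : X) : \bar R :=
  ereal_sup [set ((dot y x)%:E - f x)%E | x in setT].

Definition dual_objective (R : realType) (X : normedModType R)
    (dot : {dot X for idfun}) (V : finType) (f : V -> X -> \bar R)
    (y : V -> X) : \bar R :=
  (\sum_(i : V) conjugate dot (f i) (y i))%E.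

Definition dual_feasible (R : realType) (X : normedModType R) (V : finType) :
    set (V -> X) :=
  [set y | \sum_(i : V) y i = 0].

(* [directional_derivative G y d l] reads "G'(y; d) exists and equals l".  As
   usual it only exists at points y where G is finite; the value l may be
   infinite. *)
Definition directional_derivative (R : realType) (X : normedModType R)
    (V : finType) (G : (V -> X) -> \bar R) (y d : V -> X) (l : \bar R) : Prop :=
  G y \is a fin_num /\
  ((G (fun i => y i + t *: d i)%R - G y) * (t^-1)%:E)%E @[t --> 0^'+] --> l.

Definition direction_space (R : realType) (X : normedModType R) (V : finType)
    (S : {set V}) : set (V -> X) :=
  [set d | \sum_(i : V) d i = 0 /\ forall i, d i != 0 -> i \in S].

Definition minimizer_on (R : realType) (X : normedModType R) (V : finType)
    (C : set (V -> X)) (G : (V -> X) -> \bar R) (y : V -> X) : Prop :=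
  C y /\ forall z, C z -> (G y <= G z)%E.

(* S 0 plays no role: the n-th iteration uses S n and produces y n, n >= 1. *)
Definition dual_ascent (R : realType) (X : normedModType R)
    (dot : {dot X for idfun}) (V : finType) (f : V -> X -> \bar R)
    (S : nat -> {set V}) (y : nat -> V -> X) : Prop :=
  dual_feasible (y 0%N) /\
  forall n : nat, (1 <= n)%N ->
    [/\ (2 <= #|S n|)%N,
        \sum_(i in S n) y n i = \sum_(i in S n) y n.-1 i,
        forall z : V -> X,
          \sum_(i in S n) z i = \sum_(i in S n) y n.-1 i ->
          (- (\sum_(i in S n) conjugate dot (f i) (z i))
             <= - (\sum_(i in S n) conjugate dot (f i) (y n i)))%E
      & forall i, i \notin S n -> y n i = y n.-1 i].

(* The identity G'(y; d) = G'(y; d1) + G'(y; d2) includes the existence of the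
   three derivatives and of the sum l1 + l2 (no +oo - oo).  Since y is
   arbitrary, S1 = S2 and d = 0 already make G finite everywhere. *)
Definition decomposable (R : realType) (X : normedModType R) (V : finType)
    (G : (V -> X) -> \bar R) (S1 S2 : {set V}) : Prop :=
  forall y d : V -> X, direction_space (S1 :|: S2) d ->
  exists d1 d2 : V -> X,
    [/\ direction_space S1 d1, direction_space S2 d2,
        (forall i, d i = d1 i + d2 i)
      & exists l1 l2 : \bar R,
          [/\ directional_derivative G y d1 l1,
              directional_derivative G y d2 l2,
              (l1 +? l2)%E
            & directional_derivative G y d (l1 + l2)%E]].

(* The competitor set C is explicit because "minimizer of G" can be read over
   the whole product space (C = setT) or over the constraint set of the dual
   problem (C = dual_feasible). *)
Definition stationary_implies_minimizer (R : realType) (X : normedModType R)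
    (V : finType) (C : set (V -> X)) (G : (V -> X) -> \bar R)
    (T : nat) (S : nat -> {set V}) (n : nat) : Prop :=
  forall y : V -> X, C y ->
    (forall r : nat, (1 <= r <= T)%N ->
       forall d : V -> X, direction_space (S (n + r)%N) d ->
       exists2 l : \bar R, directional_derivative G y d l & (0 <= l)%E) ->
    minimizer_on C G y.

(* Main.v *)
(* G is finite everywhere, because (a) with S' = S'' asks for derivatives at
   every point, so each conjugate is a finite convex function on a finite
   dimensional space, hence continuous.  Take limits along an ultrafilter on
   the iterations that converges to the cluster point: the sets of the window
   become constant, y (n + r) converges to some z r by boundedness, the values
   G (z r) all agree because G (y n) is nonincreasing, and z r minimizes G over
   z (r - 1) + D(S r).  Going backwards through the window with the help of (a),
   z 0 is optimal in the directions of every S r, and (b) applies. *)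
Require Import Defs.
From mathcomp Require Import all_boot all_order all_algebra.
From mathcomp Require Import all_classical all_reals all_analysis.
From mathcomp Require Import ring lra.
Set Implicit Arguments.
Unset Strict Implicit.
Unset Printing Implicit Defensive.
Import Order.TTheory GRing.Theory Num.Theory.
Import numFieldNormedType.Exports.
Local Open Scope classical_set_scope.
Local Open Scope ring_scope.

Lemma cvg_sum (K : numFieldType) (W : normedModType K) (T : Type)
    (F : set_system T) (FF : Filter F) (I : Type) (s : seq I)
    (u : I -> T -> W) (l : I -> W) :
  (forall i, u i x @[x --> F] --> l i) ->
  \sum_(i <- s) u i x @[x --> F] --> \sum_(i <- s) l i.
Proof.
move=> ul; apply: cvg_big => //; exact: add_continuous.
Qed.

(** * Cauchy-Schwarz, orthonormal frames and compactness in finite dimension *)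

Section InnerProduct.
Variables (R : realType) (X : normedModType R) (dot : {dot X for idfun}).
Hypothesis dot_norm : norm_from_dot dot.

Lemma dotC (x z : X) : dot x z = dot z x.
Proof. by rewrite (@hermC _ _ _ _ dot) expr0 mul1r. Qed.

Lemma dotZl a (x z : X) : dot (a *: x) z = a * dot x z.
Proof. exact: linearZl_LR. Qed.

Lemma dotZr a (x z : X) : dot x (a *: z) = a * dot x z.
Proof. exact: linearZr_LR. Qed.

Lemma dot0r (x : X) : dot x 0 = 0.
Proof. exact: linear0r. Qed.

Lemma dotDl (x x' z : X) : dot (x + x') z = dot x z + dot x' z.
Proof. exact: linearDl. Qed.

Lemma dotBl (x x' z : X) : dot (x - x') z = dot x z - dot x' z.
Proof. exact: linearBl. Qed.

Lemma dotBr (x z z' : X) : dot x (z - z') = dot x z - dot x z'.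
Proof. exact: linearBr. Qed.

Lemma dot_sumr (I : Type) (s : seq I) (F : I -> X) (z : X) :
  dot z (\sum_(i <- s) F i) = \sum_(i <- s) dot z (F i).
Proof. exact: linear_sumr. Qed.

Lemma dot_suml (I : Type) (s : seq I) (F : I -> X) (z : X) :
  dot (\sum_(i <- s) F i) z = \sum_(i <- s) dot (F i) z.
Proof. by rewrite dotC dot_sumr; apply: eq_bigr => i _; exact: dotC. Qed.

(** The squared norm of [dot z z *: x - dot x z *: z] is [dot z z] times the gap
    [dot z z * dot x x - dot x z ^+ 2]. *)
Lemma dot_CauchySchwarz (x z : X) : `|dot x z| <= `|x| * `|z|.
Proof.
have [->|z0] := eqVneq z 0; first by rewrite dot0r !normr0 mulr0.
rewrite -(@ler_pXn2r _ 2) ?nnegrE ?mulr_ge0 // real_normK ?num_real// exprMn.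
rewrite !dot_norm.
have zz : 0 < dot z z by rewrite -dot_norm exprn_gt0 // normr_gt0.
have : 0 <= dot (dot z z *: x - dot x z *: z) (dot z z *: x - dot x z *: z).
  by rewrite -dot_norm sqr_ge0.
rewrite dotBl !dotBr !dotZl !dotZr /= (dotC z x).
set a := dot z z in zz *; set b := dot x z; set c := dot x x => h.
rewrite -(ler_pM2l zz) -subr_ge0; apply: le_trans h _.
by rewrite le_eqVlt; apply/orP; left; apply/eqP; ring.
Qed.

Lemma dot_continuous (e : X) : continuous (fun x => dot x e : R).
Proof.
move=> x; apply/cvgrPdist_le => /= eps eps0.
have e1 : 0 < `|e| + 1 by rewrite ltr_wpDl.
near=> z.
rewrite -dotBl; apply: le_trans (dot_CauchySchwarz _ _) _.
apply: (@le_trans _ _ (`|x - z| * (`|e| + 1))).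
  by rewrite ler_wpM2l // lerDl.
rewrite -ler_pdivlMr //; near: z.
by apply: cvgr_dist_le; [exact: cvg_id|exact: divr_gt0].
Unshelve. all: by end_near. Qed.

Local Notation P es := (fun v => \sum_(i < size es) dot v es`_i *: es`_i).

(* Gram-Schmidt.  Requiring the symmetric operator [P es] to fix [es] as well
   makes it idempotent, so orthonormality of [es] need not be mentioned. *)
Lemma orthonormal_frame_seq (bs : seq X) :
  exists es : seq X, forall v, v \in bs ++ es -> P es v = v.
Proof.
elim: bs => [|b bs [es IH]]; first by exists [::].
have PB u v : P es (u - v) = P es u - P es v.
  by rewrite -sumrB; apply: eq_bigr => i _; rewrite dotBl scalerBl.
have PZ a v : P es (a *: v) = a *: P es v.
  by rewrite scaler_sumr; apply: eq_bigr => i _; rewrite dotZl scalerA.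
have Psym u v : dot (P es u) v = dot u (P es v).
  rewrite dot_suml dot_sumr; apply: eq_bigr => i _.
  by rewrite dotZl dotZr /= (dotC v) mulrC.
have Pes v : P es (P es v) = P es v.
  rewrite [LHS](_ : _ = \sum_(i < size es) dot v es`_i *: P es es`_i);
    last first.
    under [RHS]eq_bigr do rewrite scaler_sumr.
    rewrite exchange_big /=; apply: eq_bigr => j _.
    rewrite dot_suml scaler_suml; apply: eq_bigr => i _.
    by rewrite dotZl scalerA.
  by apply: eq_bigr => i _; rewrite IH // mem_cat mem_nth ?orbT.
have [r0|r0] := eqVneq (b - P es b) 0.
  exists es => v; rewrite cat_cons in_cons => /orP[/eqP->|]; last exact: IH.
  by apply/esym/eqP; rewrite -subr_eq0 r0.
set r := b - P es b in r0; set e := `|r|^-1 *: r.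
have Pr : P es r = 0 by rewrite PB Pes subrr.
have Pe : P es e = 0 by rewrite PZ Pr scaler0.
have n0 : `|r| != 0 by rewrite normr_eq0.
have ee : dot e e = 1.
  by rewrite dotZl dotZr /= -dot_norm; field.
have be : b = P es b + `|r| *: e.
  by rewrite scalerA divff // scale1r addrC subrK.
have P'E v : P (rcons es e) v = P es v + dot v e *: e.
  rewrite size_rcons big_ord_recr /= nth_rcons ltnn eqxx; congr (_ + _).
  by apply: eq_bigr => i _; rewrite nth_rcons ltn_ord.
(* [P es] is symmetric and kills [e], so the term added to the operator vanishes on every vector
   that [P es] fixes. *)
have fixe v : P es v = v -> dot v e = 0 by move=> <-; rewrite Psym Pe dot0r.
exists (rcons es e) => v.
rewrite P'E cat_cons in_cons -cats1 catA mem_cat mem_seq1.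
move=> /orP[/eqP->|/orP[vin|/eqP->]].
- rewrite [dot b e](_ : _ = `|r|); first by rewrite -be.
  by rewrite be dotDl dotZl /= ee mulr1 fixe // add0r.
- by rewrite fixe ?IH // scale0r addr0.
- by rewrite Pe ee scale1r add0r.
Qed.

Lemma orthonormal_frame : finite_dimensional X ->
  exists es : seq X, forall v, v = \sum_(i < size es) dot v es`_i *: es`_i.
Proof.
move=> [m [b bspan]]; have [es esP] := orthonormal_frame_seq (codom b).
exists es => v; have [c ->] := bspan v; symmetry.
under eq_bigr do rewrite dot_suml scaler_suml.
rewrite exchange_big /=; apply: eq_bigr => j _.
rewrite -[in RHS](esP (b j)) ?mem_cat ?codom_f // scaler_sumr.
by apply: eq_bigr => i _; rewrite dotZl scalerA.
Qed.

(** Cauchy-Schwarz bounds the frame coordinates, so the ball lies in the image of a compact box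
    under a continuous linear map. *)
Lemma bounded_subset_compact (M : R) : finite_dimensional X ->
  exists2 K : set X, compact K & forall x, `|x| <= M -> K x.
Proof.
move=> /orthonormal_frame[es esP].
pose L (c : 'rV[R]_(size es)) : X := \sum_(i < size es) c ord0 i *: es`_i.
pose I i : set R := [set` `[- (M * `|es`_i|), M * `|es`_i|]].
exists (L @` [set c : 'rV[R]_(size es) |
              forall i : 'I_(size es), I i (c ord0 i)]).
  apply: continuous_compact; last first.
    by apply: (@rV_compact R _ (fun i : 'I__ => I i)) => i;
      exact: segment_compact.
  apply: continuous_subspaceT => c.
  have := @cvg_sum R X _ _ (nbhs_filter c) _ (index_enum _)
    (fun i (v : 'rV[R]_(size es)) => v ord0 i *: es`_i)
    (fun i => c ord0 i *: es`_i).
  apply => i; apply: cvgZr_tmp; exact: coord_continuous.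
move=> x xM; exists (\row_i dot x es`_i).
  move=> i /=; rewrite mxE /I /= in_itv /= -ler_norml.
  by apply: le_trans (dot_CauchySchwarz _ _) _; rewrite ler_wpM2r.
by rewrite /L [RHS]esP; apply: eq_bigr => i _; rewrite mxE.
Qed.

End InnerProduct.

(** * Continuity of finite convex functions *)

Section ConvexContinuity.
Variables (R : realType) (X : normedModType R) (phi : X -> R).
Hypothesis phi_convex : forall (x z : X) (t : R), 0 <= t <= 1 ->
  phi (t *: x + (1 - t) *: z) <= t * phi x + (1 - t) * phi z.

Lemma convex_midpoint (x z : X) :
  phi (2^-1 *: (x + z)) <= 2^-1 * (phi x + phi z).
Proof.
have -> : 2^-1 *: (x + z) = 2^-1 *: x + (1 - 2^-1) *: z.
  by rewrite scalerDr; congr (_ + _ *: _); lra.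
by apply: le_trans (phi_convex _ _ _) _; lra.
Qed.

(** [x + s *: e] is a convex combination of [x] and one of [x + e], [x - e]; [M] dominates both
    increments. *)
Lemma convex_line_bound (x e : X) : exists2 M, 0 <= M &
  forall s, `|s| <= 1 -> phi (x + s *: e) <= phi x + `|s| * M.
Proof.
exists (`|phi (x + e) - phi x| + `|phi (x - e) - phi x|).
  by rewrite addr_ge0.
move=> s s1.
have h u : `|phi (x + u) - phi x| <=
    `|phi (x + e) - phi x| + `|phi (x - e) - phi x| ->
    phi (x + `|s| *: u) <=
    phi x + `|s| * (`|phi (x + e) - phi x| + `|phi (x - e) - phi x|).
  set M := `|phi (x + e) - phi x| + _ => uM.
  have -> : x + `|s| *: u = `|s| *: (x + u) + (1 - `|s|) *: x.
    by rewrite scalerDr scalerBl scale1r [RHS]addrC addrA subrK.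
  apply: le_trans (phi_convex _ _ _) _; first by rewrite normr_ge0.
  have := ler_wpM2l (normr_ge0 s) (le_trans (ler_norm _) uM); lra.
have [s0|s0] := leP 0 s.
  by have := h e; rewrite (ger0_norm s0) lerDl; apply.
have := h (- e); rewrite (ltr0_norm s0) scaleNr scalerN opprK; apply.
by rewrite lerDr.
Qed.

(* [x + c0 e + w] is the midpoint of [x + 2 c0 e] and [x + 2 w]. *)
Lemma convex_upper_bound_near (es : seq X) : forall (x : X) (eps : R),
    0 < eps ->
  exists2 delta, 0 < delta & forall c : nat -> R,
    (forall i, `|c i| <= delta) ->
    phi (x + \sum_(i < size es) c i *: es`_i) <= phi x + eps.
Proof.
elim: es => [|e es IH] x eps eps0.
  by exists 1 => // c _; rewrite big_ord0 addr0 lerDl ltW.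
have [d d0 Hd] := IH x _ eps0.
have [M M0 HM] := convex_line_bound x e.
(* The three bounds serve, in turn, the induction hypothesis at doubled coefficients, the range of
   [convex_line_bound] at [2 * c 0], and the estimate [2 * |c 0| * M <= eps]; [M + 1] keeps the
   divisor positive. *)
exists (Num.min (d / 2) (Num.min (1 / 2) (eps / (2 * (M + 1))))).
  rewrite !lt_min !divr_gt0 //= mulr_gt0 //; lra.
move=> c; pose m := Num.min (d / 2) (Num.min (1 / 2) (eps / (2 * (M + 1)))).
rewrite -/m => cm.
have [m1 m2 m3] : [/\ m <= d / 2, m <= 1 / 2 & m * (2 * (M + 1)) <= eps].
  rewrite -ler_pdivlMr ?mulr_gt0 //; last lra.
  by rewrite /m !ge_min !lexx !orbT.
rewrite big_ord_recl /=.
set w := \sum_(i < _) _.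
have -> : x + (c 0%N *: e + w) =
    2^-1 *: ((x + (2 * c 0%N) *: e) + (x + 2 *: w)).
  rewrite !scalerDr !scalerA mulrA mulVf ?pnatr_eq0 // mul1r scale1r addrACA.
  by rewrite -scalerDl (_ : 2^-1 + 2^-1 = 1) ?scale1r //; lra.
apply: le_trans (convex_midpoint _ _) _.
have wE : 2 *: w = \sum_(i < size es) (2 * c i.+1) *: es`_i.
  by rewrite scaler_sumr; apply: eq_bigr => i _; rewrite scalerA.
have h1 : phi (x + 2 *: w) <= phi x + eps.
  rewrite wE; apply: (Hd (fun i => 2 * c i.+1)) => i.
  by rewrite normrM ger0_norm //; have := cm i.+1; lra.
have c2 : `|2 * c 0%N| = 2 * `|c 0%N| by rewrite normrM ger0_norm.
have h2 : phi (x + (2 * c 0%N) *: e) <= phi x + 2 * `|c 0%N| * M.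
  by rewrite -c2; apply: HM; rewrite c2; have := cm 0%N; lra.
have h3 : 2 * `|c 0%N| * M <= eps.
  apply: le_trans m3.
  have := cm 0%N; have := normr_ge0 (c 0%N); nra.
lra.
Qed.

(** The upper bound, read in frame coordinates, gives upper semicontinuity; a reflection through [x]
    then gives the lower one. *)
Lemma convex_continuous (dot : {dot X for idfun}) :
  norm_from_dot dot -> finite_dimensional X -> continuous phi.
Proof.
move=> dot_norm /(orthonormal_frame dot_norm)[es esP] x.
have usc eps : 0 < eps -> \forall z \near x, phi z <= phi x + eps.
  move=> eps0; have [d d0 Hd] := convex_upper_bound_near es x eps0.
  have : \forall z \near x, forall i : 'I_(size es),
      `|dot z es`_i - dot x es`_i| <= d.
    apply: filter_forall => i.
    under eq_near do rewrite distrC.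
    by have := @dot_continuous _ _ _ dot_norm es`_i x => /cvgrPdist_le; apply.
  apply: filterS => z zd.
  rewrite -[z](subrK x) addrC (esP (z - x)).
  pose c i := if (i < size es)%N then dot (z - x) es`_i else 0.
  rewrite (eq_bigr (fun i : 'I_(size es) => c i *: es`_i)); last first.
    by move=> i _; rewrite /c ltn_ord.
  apply: Hd => i; rewrite /c; case: ifPn => [i_lt|_].
    by rewrite dotBl; have := zd (Ordinal i_lt).
  by rewrite normr0 ltW.
apply/cvgrPdist_le => eps eps0.
have E : 2 *: x - x = x by rewrite scaler_nat mulr2n addrK.
(* [z] and [2 x - z] have midpoint [x], so the upper bound at [2 x - z] yields
   a lower bound at [z]. *)
have refl : 2 *: x - z @[z --> x] --> x.
  suff: 2 *: x - z @[z --> x] --> 2 *: x - x by rewrite E.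
  by apply: cvgB; [exact: cvg_cst|exact: cvg_id].
have lsc := refl _ (usc _ eps0).
near=> z.
have h1 : phi z <= phi x + eps by near: z; exact: usc.
have h2 : phi (2 *: x - z) <= phi x + eps by near: z; exact: lsc.
have := convex_midpoint z (2 *: x - z).
rewrite addrC subrK scalerA mulVf ?scale1r ?pnatr_eq0 // => h3.
by rewrite ler_norml; lra.
Unshelve. all: by end_near. Qed.

End ConvexContinuity.

(** * Limits along ultrafilters *)

(** The image filter clusters at some [l] in [K], and it converges there because [U] contains each
    preimage or its complement. *)
Lemma cvg_ultra_compact (T : Type) (W : topologicalType) (U : set_system T)
    (u : T -> W) (K : set W) :
  UltraFilter U -> compact K -> (forall t, K (u t)) ->
  exists l : W, u t @[t --> U] --> l.
Proof.
move=> UU cK uK.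
have FU : ProperFilter (u t @[t --> U]) by apply: fmap_proper_filter.
have KU : (u t @[t --> U]) K by exact: (@filterE _ U _ (u @^-1` K) uK).
have [l [_ ul]] := cK _ FU KU.
exists l => A Al.
have [//|UA] := in_ultra_setVsetC (u @^-1` A) UU.
by have [w []] := ul (~` A) A UA Al.
Qed.

(** If [U] excluded each of the finitely many values, it would exclude all at once, leaving no value
    for [s]. *)
Lemma ultra_near_const (T : Type) (I : finType) (U : set_system T)
    (s : T -> I) :
  UltraFilter U -> exists a, \forall t \near U, s t = a.
Proof.
move=> UU; apply: contrapT => no.
have : \forall t \near U, forall a, s t <> a.
  apply: filter_forall => a.
  have [sa|//] := in_ultra_setVsetC [set t | s t = a] UU.
  by case: no; exists a.
by move=> /filter_ex[t /(_ (s t))].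
Qed.

(* Stands for the extraction of a convergent subsequence. *)
Lemma cluster_ultra (W : topologicalType) (u : nat -> W) (l : W) :
  cluster (u @ \oo) l ->
  exists U : set_system nat,
    [/\ UltraFilter U, \oo `<=` U & u n @[n --> U] --> l].
Proof.
move=> ul.
(* Tails of the index set cut with preimages of neighbourhoods of [l] form a filter base; clustering
   makes its members nonempty. *)
pose B (p : set nat * set W) : set nat := p.1 `&` u @^-1` p.2.
pose D : set (set nat * set W) := [set p | \oo p.1 /\ nbhs l p.2].
have FB : Filter (filter_from D B).
  apply: filter_from_filter.
    by exists (setT, setT); split; apply: filterT.
  move=> [A1 A2] [B1 B2] [/= oA nA] [/= oB nB].
  exists (A1 `&` B1, A2 `&` B2); first by split; apply: filterI.
  by move=> n [[/= ? ?] [? ?]].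
have PB : ProperFilter (filter_from D B).
  apply: filter_from_proper => -[N A] [/= oN nA].
  have [|_ [[n Nn <-] An]] := ul (u @` N) A _ nA.
    by apply: filterS oN => n Nn; exists n.
  by exists n.
have [U [UU BU]] := ultraFilterLemma PB.
exists U; split => // A hA; apply: BU.
  by exists (A, setT); [split => //; exact: filterT|move=> n []].
by exists (setT, A); [split => //; exact: filterT|move=> n []].
Qed.

(** A supremum of affine functions: a [u] with [f u = +oo] contributes [-oo], and finiteness
    excludes [f u = -oo]. *)
Lemma fine_conjugate_convex (R : realType) (X : normedModType R)
    (dot : {dot X for idfun}) (f : X -> \bar R) :
  (forall z, conjugate dot f z \is a fin_num) ->
  forall (x z : X) (t : R), 0 <= t <= 1 ->
    fine (conjugate dot f (t *: x + (1 - t) *: z)) <=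
    t * fine (conjugate dot f x) + (1 - t) * fine (conjugate dot f z).
Proof.
move=> ffin x z t /andP[t0 t1].
rewrite -lee_fin fineK //; apply: ge_ereal_sup => _ [u _ <-].
have ub v : ((dot v u)%:E - f u <= (fine (conjugate dot f v))%:E)%E.
  by rewrite fineK //; apply: ereal_sup_ubound; exists u.
have := ub x; have := ub z; case: (f u) => [r||] //=.
  rewrite -!EFinB !lee_fin dotDl !dotZl => hz hx.
  have t1' : 0 <= 1 - t by rewrite subr_ge0.
  have := ler_wpM2l t0 hx; have := ler_wpM2l t1' hz; lra.
by move=> _ _; rewrite addeNy leNye.
Qed.

(** * Admissible directions *)

Section DirectionSpace.
Variables (R : realType) (X : normedModType R) (V : finType).
Implicit Types (S : {set V}) (d : V -> X).

Lemma direction_space_eq0 S d i : direction_space S d -> i \notin S -> d i = 0.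
Proof. by move=> [_ dS]; apply: contraNeq => /dS. Qed.

Lemma direction_space_sum_in S d :
  direction_space S d -> \sum_(i in S) d i = 0.
Proof.
move=> Dd; have := Dd.1; rewrite (bigID (mem S)) /=.
by rewrite [X in _ + X]big1 ?addr0 // => i /(direction_space_eq0 Dd).
Qed.

Lemma direction_spaceD S d d' : direction_space S d -> direction_space S d' ->
  direction_space S (fun i => d i + d' i).
Proof.
move=> Dd Dd'; split; first by rewrite big_split /= Dd.1 Dd'.1 addr0.
move=> i; apply: contra_neqT => iS.
by rewrite !(direction_space_eq0 _ iS) ?addr0.
Qed.

Lemma direction_spaceZ S d (t : R) :
  direction_space S d -> direction_space S (fun i => t *: d i).
Proof.
move=> Dd; split; first by rewrite -scaler_sumr Dd.1 scaler0.
move=> i; apply: contra_neqT => iS.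
by rewrite (direction_space_eq0 Dd iS) scaler0.
Qed.

Lemma direction_space_sub S S' d :
  S \subset S' -> direction_space S d -> direction_space S' d.
Proof. by move=> /fintype.subsetP SS' [d0 dS]; split=> // i /dS /SS'. Qed.

End DirectionSpace.

(** * Directional optimality and directional derivatives *)

Definition directionally_optimal (R : realType) (X : normedModType R)
    (V : finType) (g : (V -> X) -> R) (S : {set V}) (z : V -> X) :=
  forall d, direction_space S d -> g z <= g (fun i => z i + d i).

Section DirectionalDerivative.
Variables (R : realType) (X : normedModType R) (V : finType).
Variables (G : (V -> X) -> \bar R) (g : (V -> X) -> R).
Hypothesis GE : forall z, G z = (g z)%:E.
Hypothesis g_convex : forall (z d : V -> X) (t : R), 0 <= t <= 1 ->
  g (fun i => z i + t *: d i) <= (1 - t) * g z + t * g (fun i => z i + d i).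
Implicit Types (S : {set V}) (z d : V -> X).

Lemma directional_derivative_ge0 S z d l : directionally_optimal g S z ->
  direction_space S d -> directional_derivative G z d l -> (0 <= l)%E.
Proof.
move=> zopt Dd [_ dl]; apply: (cvge_to_ge dl).
near=> t; rewrite !GE -EFinB -EFinM lee_fin mulr_ge0 //.
  by rewrite subr_ge0; apply: zopt; exact: direction_spaceZ.
by rewrite invr_ge0; near: t; exact: nbhs_right_ge.
Unshelve. all: by end_near. Qed.

(** By convexity each difference quotient with [0 < t <= 1] is at most the full increment, hence so
    is the derivative. *)
Lemma directional_derivative_ge0_le z d l :
  directional_derivative G z d l -> (0 <= l)%E ->
  g z <= g (fun i => z i + d i).
Proof.
move=> [_ dl] l0; rewrite -subr_ge0 -lee_fin; apply: (le_trans l0).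
apply: (cvge_to_le dl); near=> t.
have t0 : 0 < t by near: t; exact: nbhs_right_gt.
have t1 : t <= 1 by near: t; exact: nbhs_right_le.
rewrite !GE -EFinB -EFinM lee_fin ler_pdivrMr //.
have : 0 <= t <= 1 by rewrite ltW.
by move=> /(g_convex z d); lra.
Unshelve. all: by end_near. Qed.

(** The derivative along [d] is a sum of two nonnegative ones; convexity turns its sign back into a
    comparison of values. *)
Lemma directionally_optimalU S1 S2 z : decomposable G S1 S2 ->
  directionally_optimal g S1 z -> directionally_optimal g S2 z ->
  directionally_optimal g (S1 :|: S2) z.
Proof.
move=> dec z1 z2 d Dd.
have [d1 [d2 [D1 D2 _ [l1 [l2 [h1 h2 _ h]]]]]] := dec z d Dd.
apply: (directional_derivative_ge0_le h).
by apply: adde_ge0; [exact: directional_derivative_ge0 z1 D1 h1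
                    |exact: directional_derivative_ge0 z2 D2 h2].
Qed.

(** Decomposability of [S] with itself supplies the existence of the derivative, optimality its
    sign. *)
Lemma directionally_optimal_derivative S z d : decomposable G S S ->
  directionally_optimal g S z -> direction_space S d ->
  exists2 l, directional_derivative G z d l & (0 <= l)%E.
Proof.
move=> dec zopt Dd.
have [|_ [_ [_ _ _ [l1 [l2 [_ _ _ h]]]]]] := dec z d.
  by rewrite finset.setUid.
by exists (l1 + l2)%E => //; exact: directional_derivative_ge0 zopt Dd h.
Qed.

Lemma directionally_optimal_shift S z z' : directionally_optimal g S z ->
  direction_space S (fun i => z' i - z i) -> g z' = g z ->
  directionally_optimal g S z'.
Proof.
move=> zopt Dz zz' d Dd; rewrite zz'.
have := zopt _ (direction_spaceD Dz Dd).
by rewrite (_ : (fun i => _) = (fun i => z' i + d i)) //;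
  apply/funext => i; rewrite addrA subrKC.
Qed.

End DirectionalDerivative.

(** * Separable convex functions and a window of block minimizations *)

Section SeparableFunction.
Variables (R : realType) (X : normedModType R) (V : finType).
Variables (phi : V -> X -> R) (G : (V -> X) -> \bar R).
Let g (z : V -> X) := \sum_i phi i (z i).
Hypothesis GE : forall z, G z = (g z)%:E.
Hypothesis phi_convex : forall i (x z : X) (t : R), 0 <= t <= 1 ->
  phi i (t *: x + (1 - t) *: z) <= t * phi i x + (1 - t) * phi i z.

Lemma separable_convex (z d : V -> X) (t : R) : 0 <= t <= 1 ->
  g (fun i => z i + t *: d i) <= (1 - t) * g z + t * g (fun i => z i + d i).
Proof.
move=> t01; rewrite /g !mulr_sumr -big_split /=; apply: ler_sum => i _.
rewrite [leRHS]addrC; apply: le_trans (phi_convex _ _ _ t01).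
suff -> : t *: (z i + d i) + (1 - t) *: z i = z i + t *: d i by [].
by rewrite scalerDr scalerBl scale1r addrC addrA subrK.
Qed.

(** A direction in [S2] moves only coordinates where [z] and [z'] agree, so both see the same
    increment of [g]. *)
Lemma directionally_optimal_disjoint (S1 S2 : {set V}) (z z' : V -> X) :
  S1 :&: S2 = finset.set0 -> direction_space S1 (fun i => z' i - z i) ->
  directionally_optimal g S2 z -> directionally_optimal g S2 z'.
Proof.
move=> S12 Dz zopt d Dd; have := zopt d Dd.
rewrite -subr_ge0 -[in X in _ -> X]subr_ge0 /g -!sumrB.
rewrite (eq_bigr (fun i => phi i (z' i + d i) - phi i (z' i))) // => i _.
have [iS|iS] := boolP (i \in S2); last first.
  by rewrite (direction_space_eq0 Dd iS) !addr0 !subrr.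
have iS1 : i \notin S1.
  apply/negP => iS1; have := finset.in_set0 i.
  by rewrite -S12 finset.inE iS1 iS.
by have /eqP := direction_space_eq0 Dz iS1; rewrite subr_eq0 => /eqP ->.
Qed.

(* Optimality of [z r] in the directions of [S q] propagates backwards from
   [r] to [r - 1]: either [S r] and [S q] are disjoint and the move from
   [z (r - 1)] to [z r] is invisible to [S q], or [z r] is optimal for
   [S r :|: S q] and [z (r - 1)] has the same value. *)
Lemma window_optimal (T : nat) (S : nat -> {set V}) (z : nat -> V -> X) :
  (forall p q, (1 <= p <= T)%N -> (1 <= q <= T)%N ->
    S p :&: S q != finset.set0 -> decomposable G (S p) (S q)) ->
  (forall r, (1 <= r <= T)%N ->
    direction_space (S r) (fun i => z r i - z r.-1 i)) ->
  (forall r, (1 <= r <= T)%N -> forall d, direction_space (S r) d ->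
    g (z r) <= g (fun i => z r.-1 i + d i)) ->
  (forall r, g (z r) = g (z 0%N)) ->
  forall q, (1 <= q <= T)%N -> directionally_optimal g (S q) (z 0%N).
Proof.
move=> dec zD zmin zval.
(* Only the sets after index [T - k] are treated at stage [k]: none at [k = 0], the whole window at
   [k = T]. *)
suff H k : (k <= T)%N -> forall q, (T - k < q <= T)%N ->
    directionally_optimal g (S q) (z (T - k)%N).
  by move=> q qT; have := H T (leqnn _) q; rewrite subnn; apply.
elim: k => [|k IH] kT q; first by rewrite subn0 ltnNge => /andP[/negbTE->].
have rE : (T - k.+1)%N = (T - k).-1 by rewrite subnS.
have rT : (1 <= T - k <= T)%N by rewrite subn_gt0 kT leq_subr.
rewrite rE prednK; last by case/andP: rT.
set r := (T - k)%N in rT IH *; move=> /andP[rq qT].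
have qT' : (1 <= q <= T)%N by rewrite qT (leq_trans _ rq) //; case/andP: rT.
have back : direction_space (S r) (fun i => z r.-1 i - z r i).
  have := direction_spaceZ (-1) (zD _ rT); congr direction_space.
  by apply/funext => i; rewrite scaleN1r opprB.
have ropt : directionally_optimal g (S r) (z r).
  move=> d Dd; have := zmin _ rT _ (direction_spaceD (zD _ rT) Dd).
  by rewrite (_ : (fun i => _) = (fun i => z r i + d i)) //;
    apply/funext => i; rewrite addrA subrKC.
move: rq; rewrite leq_eqVlt => /orP[/eqP<-|rq].
  by apply: directionally_optimal_shift ropt back _; rewrite !zval.
have qopt : directionally_optimal g (S q) (z r).
  by apply: IH; rewrite ?rq // ltnW.
have [S0|S0] := eqVneq (S r :&: S q) finset.set0.
  exact: directionally_optimal_disjoint S0 back qopt.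
have Uopt : directionally_optimal g (S r :|: S q) (z r).
  exact: (directionally_optimalU GE separable_convex (dec _ _ rT qT' S0)).
have U'opt : directionally_optimal g (S r :|: S q) (z r.-1).
  apply: directionally_optimal_shift Uopt _ _; last by rewrite !zval.
  exact: direction_space_sub (finset.subsetUl _ _) back.
move=> d Dd; apply: U'opt.
exact: direction_space_sub (finset.subsetUr _ _) Dd.
Qed.

End SeparableFunction.

(** * Feasibility and descent of the iterates *)

Section DualAscent.
Variables (R : realType) (X : normedModType R) (dot : {dot X for idfun}).
Variables (V : finType) (f : V -> X -> \bar R).
Variables (S : nat -> {set V}) (y : nat -> V -> X).
Hypothesis hy : dual_ascent dot f S y.

Lemma dual_ascent_direction n : (1 <= n)%N ->
  direction_space (S n) (fun i => y n i - y n.-1 i).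
Proof.
move=> n1; have [_ ySum _ yS] := hy.2 n n1.
have off i : i \notin S n -> y n i - y n.-1 i = 0.
  by move=> /yS ->; rewrite subrr.
split; last by move=> i; apply: contraNT => /off ->.
rewrite (bigID (mem (S n))) /= [X in _ + X]big1 ?addr0; last by move=> i /off.
by rewrite sumrB ySum subrr.
Qed.

Lemma dual_ascent_feasible n : dual_feasible (y n).
Proof.
elim: n => [|n IH]; first exact: hy.1.
have := (dual_ascent_direction (ltn0Sn n)).1.
by rewrite sumrB IH subr0.
Qed.

Hypothesis f_fin : forall i z, conjugate dot (f i) z \is a fin_num.
Let phi i z := fine (conjugate dot (f i) z).
Let g (z : V -> X) := \sum_i phi i (z i).

(** Coordinates off [S n] are frozen, so the block maximization minimizes the whole [g] over a slice
    through [y n.-1]. *)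
Lemma dual_ascent_min n : (1 <= n)%N -> forall d, direction_space (S n) d ->
  g (y n) <= g (fun i => y n.-1 i + d i).
Proof.
move=> n1 d Dd; have [_ _ ymin yS] := hy.2 n n1.
have E z : (\sum_(i in S n) conjugate dot (f i) (z i))%E =
    (\sum_(i in S n) phi i (z i))%:E.
  by rewrite -sumEFin; apply: eq_bigr => i _; rewrite fineK.
have := ymin (fun i => y n.-1 i + d i).
rewrite leeN2 !E lee_fin big_split /= (direction_space_sum_in Dd) addr0.
move=> /(_ erefl) yle.
rewrite /g (bigID (mem (S n))) [leRHS](bigID (mem (S n))) /= lerD //.
by apply: ler_sum => i iS; rewrite yS // (direction_space_eq0 Dd iS) addr0.
Qed.

(** Each step admits the competitor [d = 0]. *)
Lemma dual_ascent_nonincreasing m n : (m <= n)%N -> g (y n) <= g (y m).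
Proof.
move=> /subnK <-; elim: (n - m)%N => [|k IH] //.
apply: le_trans IH; rewrite addSn.
have := @dual_ascent_min (k + m).+1 isT (fun=> 0) _.
rewrite /= (_ : (fun i => _ + 0) = y (k + m)%N); last first.
  by apply/funext => i; rewrite addr0.
by apply; split; [rewrite big1|move=> i; rewrite eqxx].
Qed.

End DualAscent.

(** * Passage to the limit over the iterations *)

Theorem theorem3p2 (R : realType) (X : normedModType R)
    (dot : {dot X for idfun})
    (hdot : norm_from_dot dot) (hfin : finite_dimensional X)
    (V : finType) (e : rel V) (e_sym : symmetric e) (e_irr : irreflexive e)
    (e_conn : forall i j : V, connect e i j)
    (f : V -> X -> \bar R) (hf : forall i, closed_convex (f i))
    (S : nat -> {set V}) (y : nat -> V -> X)
    (hy : dual_ascent dot f S y)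
    (C : set (V -> X)) (hC : @dual_feasible R X V `<=` C)
    (T : nat)
    (ha : forall n : nat, (1 <= n)%N ->
       forall i j : nat, (1 <= i <= T)%N -> (1 <= j <= T)%N ->
         S (n + i)%N :&: S (n + j)%N != finset.set0 ->
         decomposable (dual_objective dot f) (S (n + i)%N) (S (n + j)%N))
    (hb : forall n : nat, (1 <= n)%N ->
       stationary_implies_minimizer C (dual_objective dot f) T S n)
    (hbounded : forall i : V, bounded_fun (fun n => y n i))
    (ybar : V -> X)
    (hcluster : @cluster {ptws V -> X} (y @ \oo) ybar) :
  minimizer_on C (dual_objective dot f) ybar.
Proof.
have [U [UU ooU yU]] := cluster_ultra hcluster.
have FU : ProperFilter U by exact: ultra_proper.
have yUi i : y n i @[n --> U] --> ybar i.
  exact: (cvg_comp _ _ yU (@proj_continuous V (fun=> X) i ybar)).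
(* The iterates all have coordinate sum [0], hence so does their limit. *)
have ybarC : C ybar.
  apply: hC; apply: (@cvg_unique X (@norm_hausdorff _ _)
    (\sum_i y n i @[n --> U])).
    exact: cvg_sum.
  by apply: cvg_near_cst; apply: nearW => n; exact: (dual_ascent_feasible hy).
(* For [T = 0] the premise of (b) is vacuous, so membership in [C] suffices. *)
case: (posnP T) => [T0|T0].
  by apply: (hb _ (leqnn 1)) => // r; rewrite T0; case: r.
(* Apply (a) to the nonempty set [S 2] paired with itself, at the constant family [z] with [d = 0]:
   the sum of conjugates is finite, hence each summand is. *)
have fin i z : conjugate dot (f i) z \is a fin_num.
  have T1 : (1 <= 1 <= T)%N by [].
  have S2 : S (1 + 1)%N :&: S (1 + 1)%N != finset.set0.
    have [S2 _ _ _] := hy.2 2%N isT.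
    by rewrite finset.setIid -finset.card_gt0 (leq_trans _ S2).
  have [|d1 [d2 [_ _ _ [l1 [l2 [[+ _] _ _ _]]]]]] :=
      ha _ (leqnn 1) 1%N 1%N T1 T1 S2 (fun=> z) (fun=> 0).
    by split; [rewrite big1|move=> j; rewrite eqxx].
  by move=> /sum_fin_numP; apply => //; rewrite mem_index_enum.
pose phi i z := fine (conjugate dot (f i) z).
pose g (z : V -> X) := \sum_i phi i (z i).
have GE z : dual_objective dot f z = (g z)%:E.
  by rewrite -sumEFin; apply: eq_bigr => i _; rewrite fineK.
have phi_convex i := fine_conjugate_convex (fin i).
have phi_cont i : continuous (phi i).
  exact: (convex_continuous (phi_convex i) hdot hfin).
(* Boundedness gives each shifted iterate a limit along [U]; index [0] is pinned to [ybar]. *)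
have [yb yb0 ybU] : exists2 yb : nat -> V -> X, yb 0%N = ybar &
    forall r i, y (n + r)%N i @[n --> U] --> yb r i.
  have lim r i : exists l : X, y (n + r)%N i @[n --> U] --> l.
    have [M [_ yM]] := hbounded i.
    (* [bounded_fun] yields a bound by every number strictly above [M]. *)
    have [K cK KM] := bounded_subset_compact hdot (M + 1) hfin.
    apply: (cvg_ultra_compact UU cK) => n; apply: KM.
    by apply: yM => //; rewrite ltrDl.
  have /choice[yb ybE] : forall p,
      exists l : X, y (n + p.1)%N p.2 @[n --> U] --> l.
    by move=> p; exact: lim.
  exists (fun r i => if r is r'.+1 then yb (r, i) else ybar i) => //.
  move=> [|r] i; last exact: (ybE (r.+1, i)).
  by under eq_fun do rewrite addn0; exact: yUi.
have gU r d : g (fun i => y (n + r)%N i + d i) @[n --> U] -->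
    g (fun i => yb r i + d i).
  apply: cvg_sum => i; apply: (continuous_cvg _ (phi_cont i _)).
  by apply: cvgD; [exact: ybU|exact: cvg_cst].
have gU0 r : g (y (n + r)%N) @[n --> U] --> g (yb r).
  by apply: cvg_sum => i; apply: (continuous_cvg _ (phi_cont i _)); exact: ybU.
(* [U] contains the tails, so [g (yb 0)] bounds every [g (y m)] from below; monotonicity gives the
   other inequality. *)
have yb_val r : g (yb r) = g (yb 0%N).
  have ge m : g (yb 0%N) <= g (y m).
    apply: (cvgr_to_le (gU0 0%N)); apply: ooU; exists m => // n /= mn.
    by rewrite addn0; exact: (dual_ascent_nonincreasing hy fin).
  apply/eqP; rewrite eq_le (cvgr_to_ge (gU0 r)) ?andbT.
    apply: (ler_cvg_to (gU0 r) (gU0 0%N)); apply: nearW => n.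
    by apply: (dual_ascent_nonincreasing hy fin); rewrite addn0 leq_addr.
  by apply: nearW => n.
(* The tuple of window sets ranges over a finite type, so it is constant along [U]. *)
have [Sw SwU] : exists Sw : nat -> {set V},
    \forall n \near U, forall r, (r <= T)%N -> S (n + r)%N = Sw r.
  have [a aU] := ultra_near_const
    (fun n => [ffun r : 'I_T.+1 => S (n + r)%N]) UU.
  exists (fun r => a (inord r)); apply: filterS aU => n <- r rT.
  by rewrite ffunE inordK.
have n1U : \forall n \near U, (1 <= n)%N by apply: ooU; exists 1%N.
(* An actual window that realizes the limit sets; (a) and (b) are applied to it. *)
have [n0 [n01 Sn0]] := filter_ex (filterI n1U SwU).
have predE r n : (1 <= r)%N -> (n + r.-1)%N = (n + r).-1.
  by case: r => // r _; rewrite addnS.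
(* Zero sum and vanishing off [Sw r] are closed conditions. *)
have yb_dir r : (1 <= r <= T)%N ->
    direction_space (Sw r) (fun i => yb r i - yb r.-1 i).
  move=> /andP[r1 rT].
  have dU i : y (n + r)%N i - y (n + r.-1)%N i @[n --> U] -->
      yb r i - yb r.-1 i.
    by apply: cvgB; exact: ybU.
  have yD : \forall n \near U,
      direction_space (Sw r) (fun i => y (n + r)%N i - y (n + r.-1)%N i).
    apply: filterS SwU => n /(_ r rT) <-.
    rewrite predE //; apply: (dual_ascent_direction hy).
    by rewrite addn_gt0 r1 orbT.
  split.
    apply: (@cvg_unique X (@norm_hausdorff _ _)
      (\sum_i (y (n + r)%N i - y (n + r.-1)%N i) @[n --> U])).
      exact: cvg_sum.
    apply: cvg_near_cst; apply: filterS yD => n Dn; exact: Dn.1.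
  move=> i; apply: contra_neqT => iS.
  apply: (@cvg_unique X (@norm_hausdorff _ _) _ _ _ _ (dU i)).
  by apply: cvg_near_cst; apply: filterS yD => n /direction_space_eq0; apply.
have yb_min r : (1 <= r <= T)%N -> forall d, direction_space (Sw r) d ->
    g (yb r) <= g (fun i => yb r.-1 i + d i).
  move=> /andP[r1 rT] d Dd.
  apply: (ler_cvg_to (gU0 r) (gU r.-1 d)).
  apply: filterS SwU => n /(_ r rT) Sr.
  rewrite predE //; apply: (dual_ascent_min hy fin); last by rewrite Sr.
  by rewrite addn_gt0 r1 orbT.
have Sdec p q : (1 <= p <= T)%N -> (1 <= q <= T)%N ->
    Sw p :&: Sw q != finset.set0 ->
    decomposable (dual_objective dot f) (Sw p) (Sw q).
  move=> pT qT; rewrite -!Sn0; try by case/andP: pT; case/andP: qT.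
  exact: ha.
have opt := window_optimal GE phi_convex Sdec yb_dir yb_min yb_val.
apply: (hb _ n01) => // r rT d; rewrite Sn0; last by case/andP: rT.
rewrite -yb0; apply: (directionally_optimal_derivative GE _ (opt r rT)).
have [S2 _ _ _] := hy.2 (n0 + r)%N (leq_trans n01 (leq_addr _ _)).
apply: Sdec => //; rewrite finset.setIid -Sn0; last by case/andP: rT.
by rewrite -finset.card_gt0 (leq_trans _ S2).
Qed.
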